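(* Let $w=e^{\pi i/4}$ and define the 8-qubit states $$|x_k\rangle=\frac{w^{5k}}{\sqrt8}\sum_{j=1}^8 w^{(-1)^k(j-1)}|(j)_8\rangle\ (k=0,1),\qquad |y_0\rangle=\frac1{\sqrt8}\sum_{j=1}^8(-w)^{j-1}|(j)_8\rangle,\qquad |y_1\rangle=w|x_0\rangle,$$ and the 16-qubit logical basis states $$|0^H\rangle=\frac1{\sqrt2}\big(|x_0\rangle|y_0\rangle+|x_1\rangle|y_1\rangle\big),\qquad |1^H\rangle=\frac{i}{\sqrt2}\big(|x_0\rangle|y_0\rangle-|x_1\rangle|y_1\rangle\big).$$ Consider the permutations of 8 qubits $$U=(1,6)_q(2,5)_q(3,4)_q(7,8)_q,\quad Q=(2,6)_q(4,8)_q,\quad R=(1,7)_q(2,6)_q(3,5)_q .$$ Then, up to global phases, on the span of $|0^H\rangle,|1^H\rangle$ the qubit permutation $\mathbf{H}=U\otimes Q$ acts as the logical Hadamard gate, $\mathbf{Z}=R\otimes Q$ acts as the logical phase-flip gate $Z$, $\mathbf{X}=URU\otimes Q=(1,5)_q(2,4)_q(6,8)_q\otimes Q$ acts as the logical bit-flip gate $X$, and $\mathbf{Y}=URUR\otimes I_{2^8}=(1,7,5,3)_q(2,8,6,4)_q\otimes I_{2^8}$ acts as the logical gate $XZ$.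
   Context: $|(j)_8\rangle$ is the 8-qubit computational basis state with a $|1\rangle$ in position $j$ and $|0\rangle$ in all other positions. The subscript $q$ means that a permutation written in cycle notation acts on qubits (tensor factors): the state of qubit $j$ is moved to the position to which the permutation sends $j$. Products are operator products, and $I_{2^8}$ is the identity on 8 qubits. In $V\otimes W$, $V$ acts on the first 8 qubits and $W$ on the last 8. An operator acts as a logical gate $G=(G_{ab})_{a,b\in\{0,1\}}$ up to a global phase if for some complex number $z$ of modulus one it maps $|b^H\rangle$ to $z(G_{0b}|0^H\rangle+G_{1b}|1^H\rangle)$ for $b=0,1$. Here the Hadamard gate is $\frac1{\sqrt2}\begin{pmatrix}1&1\\1&-1\end{pmatrix}$, $Z=\mathrm{diag}(1,-1)$ and $X=\begin{pmatrix}0&1\\1&0\end{pmatrix}$. *)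

(* Defs.v *)
From mathcomp Require Import all_boot all_order all_fingroup all_algebra.
From mathcomp Require Import reals trigo.
From mathcomp Require Export complex mxtens.

Set Implicit Arguments.
Unset Strict Implicit.
Unset Printing Implicit Defensive.

Import Order.TTheory GRing.Theory Num.Theory.
Local Open Scope ring_scope.

(* The n-qubit space is C^(2^n) with C = K[i], its coordinates being indexed
   by the bit strings of length n through enum_rank.  The order of the
   coordinates is that of the enumeration and plays no role below. *)
Notation bits n := {ffun 'I_n -> bool}.

Definition qdim (n : nat) : nat := #|{: bits n}|.

Lemma qdimE n : qdim n = (2 ^ n)%N.
Proof. by rewrite /qdim card_ffun card_bool card_ord. Qed.

Definition ket (K : realType) (n : nat) (b : bits n) : 'cV[K[i]]_(qdim n) :=
  delta_mx (enum_rank b) 0.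

(* The state of qubit j goes to position s j, so that position k of the
   image carries the bit that was at position s^-1 k. *)
Definition qmove (n : nat) (s : 'S_n) (b : bits n) : bits n :=
  [ffun k => b ((s^-1)%g k)].

(* \sum_b |s b><b| *)
Definition qperm (K : realType) (n : nat) (s : 'S_n) : 'M[K[i]]_(qdim n) :=
  \sum_(b : bits n) ket K (qmove s b) *m (ket K b)^T.

(* The cyclic permutation (s_1, ..., s_m), for s without repetition. *)
Definition cycle_perm (n : nat) (s : seq 'I_n) : 'S_n :=
  insubd (1%g : 'S_n) [ffun x => next s x].

(* Qubits are numbered from 1 to 8. *)
Definition qubit (j : nat) : 'I_8 := inord j.-1.

Definition cycq (K : realType) (s : seq nat) : 'M[K[i]]_(qdim 8) :=
  qperm K (cycle_perm [seq qubit j | j <- s]).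

Definition onehot (K : realType) (j : nat) : 'cV[K[i]]_(qdim 8) :=
  ket K [ffun k => k == qubit j].

(* exp(i pi / 4) *)
Definition w (K : realType) : K[i] := (cos (pi / 4) +i* sin (pi / 4))%C.

Definition ketx (K : realType) (k : nat) : 'cV[K[i]]_(qdim 8) :=
  (w K ^+ (5 * k) / sqrtC 8) *:
    \sum_(1 <= j < 9) (w K ^ ((-1) ^+ k * (j%:Z - 1))) *: onehot K j.

Definition kety0 (K : realType) : 'cV[K[i]]_(qdim 8) :=
  (sqrtC 8)^-1 *: \sum_(1 <= j < 9) (- w K) ^+ (j - 1) *: onehot K j.

Definition kety1 (K : realType) : 'cV[K[i]]_(qdim 8) := w K *: ketx K 0.

(* |u>|v>; the Kronecker product has 1 * 1 columns, which reduces to 1. *)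
Definition tensv (K : realType) (m n : nat) (u : 'cV[K[i]]_m)
  (v : 'cV[K[i]]_n) : 'cV[K[i]]_(m * n) := u *t v.

Definition ket0H (K : realType) : 'cV[K[i]]_(qdim 8 * qdim 8) :=
  (sqrtC 2)^-1 *:
    (tensv (ketx K 0) (kety0 K) + tensv (ketx K 1) (kety1 K)).

Definition ket1H (K : realType) : 'cV[K[i]]_(qdim 8 * qdim 8) :=
  ((0 +i* 1)%C / sqrtC 2) *:
    (tensv (ketx K 0) (kety0 K) - tensv (ketx K 1) (kety1 K)).

Definition ketH (K : realType) (b : 'I_2) : 'cV[K[i]]_(qdim 8 * qdim 8) :=
  if b == 0 then ket0H K else ket1H K.

Definition acts_as_gate (K : realType) (A : 'M[K[i]]_(qdim 8 * qdim 8))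
    (G : 'M[K[i]]_2) : Prop :=
  exists z : K[i], `|z| = 1 /\
    forall b : 'I_2,
      A *m ketH K b = z *: (G 0 b *: ketH K 0 + G 1 b *: ketH K 1).

Definition mx2 (T : Type) (a b c d : T) : 'M[T]_2 :=
  \matrix_(i, j) if i == 0 then (if j == 0 then a else b)
                 else (if j == 0 then c else d).

Definition gateH (K : realType) : 'M[K[i]]_2 :=
  (sqrtC 2)^-1 *: mx2 1 1 1 (-1).
Definition gateZ (K : realType) : 'M[K[i]]_2 := mx2 1 0 0 (-1).
Definition gateX (K : realType) : 'M[K[i]]_2 := mx2 0 1 1 0.

Lemma cycle_permE n (s : seq 'I_n) x : uniq s -> cycle_perm s x = next s x.
Proof.
move=> Us; rewrite /cycle_perm -pvalE val_insubd.
case: ifP; first by rewrite ffunE.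
move/negP; case; apply/injectiveP=> y z; rewrite !ffunE => e.
by rewrite -(prev_next Us y) e prev_next.
Qed.

Lemma qperm_ket (K : realType) n (s : 'S_n) (b : bits n) :
  qperm K s *m ket K b = ket K (qmove s b).
Proof.
rewrite /qperm mulmx_suml (bigD1 b) //= big1 ?addr0 => [|c ncb];
  rewrite -mulmxA /ket trmx_delta.
- by rewrite !mul_delta_mx.
- by rewrite mul_delta_mx_0 ?mulmx0 ?(inj_eq enum_rank_inj).
Qed.

Lemma qperm_onehot (K : realType) (s : 'S_8) (j k : nat) :
  s (qubit j) = qubit k -> qperm K s *m onehot K j = onehot K k.
Proof.
move=> e; rewrite qperm_ket; congr (ket K _).
by apply/ffunP=> l; rewrite !ffunE -e (can2_eq (permKV s) (permK s)).
Qed.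

(* Main.v *)
(* Put a = |x_0>|y_0> and b = |x_1>|y_1>. Up to normalisation, each of x_0,
   x_1, y_0, y_1 is a combination of the one-hot states whose coefficients are
   powers of w, and since w^8 = 1 a relabelling of the qubits turns any of them
   into a power of w times another as soon as the exponents differ by a
   constant modulo 8. In this way H, Z and X swap the lines of a and b, and Y
   preserves them, with phases w^-1 and w (H), 1 and 1 (Z), w^-2 and w^2 (X),
   w^2 and w^-2 (Y). The matrices in the basis |0^H>, |1^H> follow from w^2 = i
   and sqrt 2 = w + w^-1. *)
Require Import Defs.
From mathcomp Require Import all_boot all_order all_fingroup all_algebra.
From mathcomp Require Import reals trigo complex mxtens.
From mathcomp Require Import ring lra.

Set Implicit Arguments.
Unset Strict Implicit.
Unset Printing Implicit Defensive.

Import Order.TTheory GRing.Theory Num.Theory.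
Local Open Scope ring_scope.

(** * Qubit permutations as relabellings of 1, ..., 8 *)

Lemma qperm_mul (K : realType) (n : nat) (s t : 'S_n) :
  qperm K s *m qperm K t = qperm K (t * s)%g.
Proof.
rewrite {2}/qperm mulmx_sumr {2}/qperm; apply: eq_bigr => b _.
rewrite mulmxA qperm_ket; congr (ket K _ *m _).
by apply/ffunP=> k; rewrite !ffunE invMg permM.
Qed.

(* [f] describes the permutation in the 1-based numbering of the qubits. *)
Definition relabels (K : realType) (A : 'M[K[i]]_(qdim 8)) (f : nat -> nat) :=
  exists2 s : 'S_8, A = qperm K s & forall i : 'I_8, (s i).+1 = f i.+1.

Lemma qubitK (j : nat) : (0 < j < 9)%N -> (qubit j).+1 = j.
Proof. by case: j => // j /= lt_j8; rewrite /qubit inordK. Qed.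

Lemma qubitS (i : 'I_8) : qubit i.+1 = i.
Proof. exact: inord_val. Qed.

Lemma relabels_cycq (K : realType) (s : seq nat) :
  uniq s -> all (fun j => 0 < j < 9)%N s -> relabels (cycq K s) (next s).
Proof.
move=> Us s_le8; exists (cycle_perm [seq qubit j | j <- s]) => // i.
have s_map : [seq (val k).+1 | k <- [seq qubit j | j <- s]] = s.
  rewrite -map_comp -[RHS]map_id; apply/eq_in_map => j /(allP s_le8).
  exact: qubitK.
have Uqs : uniq [seq qubit j | j <- s].
  by apply: (@map_uniq _ _ (fun k : 'I_8 => (val k).+1)); rewrite s_map.
have inj_S : injective (fun k : 'I_8 => (val k).+1).
  by move=> k l [] /val_inj.
rewrite cycle_permE // -[in RHS]s_map.
by rewrite (next_map inj_S Uqs i).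
Qed.

Lemma relabels_mul (K : realType) (A B : 'M[K[i]]_(qdim 8)) f g :
  relabels A f -> relabels B g -> relabels (A *m B) (f \o g).
Proof.
move=> [s -> sE] [t -> tE]; exists (t * s)%g; first exact: qperm_mul.
by move=> i; rewrite permM sE /= -tE.
Qed.

(** Functions built from [next] on [nat] evaluate by computation, so an identity between permutation
    operators becomes a check of eight values. *)
Lemma eq_relabels (K : realType) (A B : 'M[K[i]]_(qdim 8)) f g :
  relabels A f -> relabels B g -> all (fun j => f j == g j) (iota 1 8) ->
  A = B.
Proof.
move=> [s -> sE] [t -> tE] /allP fg; congr qperm; apply/permP=> i.
apply/val_inj/succn_inj; rewrite sE tE; apply/eqP/(fg i.+1).
by rewrite mem_iota /= add1n ltnS.
Qed.

(** * Change of basis from [a], [b] to [a + b], [a - b] *)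

Section PlaneInMatrices.
Variables (F : comRingType) (m n : nat).
Implicit Types (c t x y p q r s : F) (a b : 'M[F]_(m, n)).

Lemma scaler_sum_diff c t x y a b :
  x *: (c *: (a + b)) + y *: ((t * c) *: (a - b)) =
  c *: ((x + t * y) *: a + (x - t * y) *: b).
Proof. by apply/matrixP=> k l; rewrite !mxE; ring. Qed.

Lemma scaler_diff_comb c t p q r s a b :
  (t * c) *: (p *: a + q *: b - (r *: a + s *: b)) =
  c *: ((t * (p - r)) *: a + (t * (q - s)) *: b).
Proof. by apply/matrixP=> k l; rewrite !mxE; ring. Qed.

Lemma scaler_tens (m' n' : nat) c t a (b : 'M[F]_(m', n')) :
  (c *: a) *t (t *: b) = (c * t) *: (a *t b).
Proof. by apply/matrixP=> k l; rewrite !mxE mulrACA. Qed.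

(** The last four equations compare the coefficients of [a] and [b], after removing the factor [c]:
    two for each column of [G]. *)
Lemma mulmx_plane (A : 'M[F]_m) (G : 'M[F]_2) (v : 'I_2 -> 'M[F]_(m, n))
    c t p q r s a b :
  v 0 = c *: (a + b) -> v 1 = (t * c) *: (a - b) ->
  A *m a = p *: a + q *: b -> A *m b = r *: a + s *: b ->
  p + r = G 0 0 + t * G 1 0 -> q + s = G 0 0 - t * G 1 0 ->
  t * (p - r) = G 0 1 + t * G 1 1 -> t * (q - s) = G 0 1 - t * G 1 1 ->
  forall k, A *m v k = G 0 k *: v 0 + G 1 k *: v 1.
Proof.
move=> v0 v1 Aa Ab e1 e2 e3 e4 k; rewrite v0 v1 scaler_sum_diff.
case: k => -[|[|//]] lt_k2.
  rewrite (_ : Ordinal _ = 0); last exact: val_inj.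
  by rewrite v0 -scalemxAr mulmxDr Aa Ab addrACA -!scalerDl e1 e2.
rewrite (_ : Ordinal _ = 1); last exact: val_inj.
by rewrite v1 -scalemxAr mulmxBr Aa Ab scaler_diff_comb e3 e4.
Qed.

End PlaneInMatrices.

(** * Arithmetic of the eighth root of unity [w] *)

Section EighthRoot.
Variable K : realType.
Local Notation w := (w K).

Lemma w_sqr : w ^+ 2 = (0 +i* 1)%C.
Proof.
have pi2 : pi / 4 + pi / 4 = pi / 2 :> K by field.
apply/eqP; rewrite expr2 eq_complex /= -cosD [cos _ * sin _ + _]addrC -sinD.
by rewrite pi2 cos_pihalf sin_pihalf !eqxx.
Qed.

Lemma w_exp4 : w ^+ 4 = -1.
Proof.
by rewrite -[4%N]/(2 * 2)%N exprM w_sqr; apply/eqP;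
  rewrite expr2 eq_complex /= !(mul0r, mulr0, mul1r, addr0, sub0r) oppr0 !eqxx.
Qed.

Lemma w_exp8 : w ^+ 8 = 1.
Proof. by rewrite -[8%N]/(4 * 2)%N exprM w_exp4 sqrrN expr1n. Qed.

Lemma w_neq0 : w != 0.
Proof.
by apply: contraNneq (oner_neq0 K[i]) => w0; rewrite -w_exp8 w0 expr0n.
Qed.

Lemma w_exp_mod (m n : nat) : (m == n %[mod 8])%N -> w ^+ m = w ^+ n.
Proof. by move/eqP=> mn; rewrite -(expr_mod m w_exp8) mn expr_mod ?w_exp8. Qed.

(* Since w^-1 = - w^3, the right hand side is w + w^-1 = 2 cos (pi / 4). *)
Lemma sqrtC2_w : sqrtC 2 = w - w ^+ 3.
Proof.
have -> : (2 : K[i]) = (w - w ^+ 3) ^+ 2.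
  have -> : (w - w ^+ 3) ^+ 2 = w ^+ 2 * (1 + w ^+ 4) - 2 * w ^+ 4 by ring.
  by rewrite w_exp4; ring.
(* [sqrCK] requires [0 <= w - w ^+ 3] in [K[i]]: the imaginary part sin - cos must vanish and the
   real part must be nonnegative. *)
rewrite sqrCK // exprS w_sqr /w; simpc.
have -> : sin (pi / 4) = cos (pi / 4) :> K.
  by rewrite -cosBpihalf -[RHS]cosN; congr cos; field.
have c_ge0 : 0 <= cos (pi / 4 : K).
  by apply: cos_ge0_pihalf; have := pi_ge0 K; lra.
by rewrite subrr eqxx addr_ge0.
Qed.

(** * States whose one-hot amplitudes are powers of [w] *)

Definition phasev (f : nat -> nat) : 'cV[K[i]]_(qdim 8) :=
  (sqrtC 8)^-1 *: \sum_(1 <= j < 9) w ^+ f j *: onehot K j.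

(** The amplitude at [j] moves to [s j], so only exponents modulo 8 need comparing, which is
    decidable. *)
Lemma relabels_phasev A s c f g :
  relabels A s ->
  all (fun j => f j == (c + g (s j))%N %[mod 8]) (iota 1 8) ->
  A *m phasev f = w ^+ c *: phasev g.
Proof.
move=> [p -> sE] /allP fg; rewrite -scalemxAr scalerA mulrC -scalerA.
congr (_ *: _); rewrite mulmx_sumr !big_add1 !big_mkord scaler_sumr /=.
rewrite [RHS](reindex_inj (@perm_inj _ p)) /=; apply: eq_bigr => i _.
rewrite -scalemxAr scalerA -exprD.
rewrite (@qperm_onehot _ p i.+1 (p i).+1) ?qubitS // sE.
have i_iota : i.+1 \in iota 1 8 by rewrite mem_iota /= add1n ltnS.
by rewrite (w_exp_mod (fg _ i_iota)).
Qed.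

(* Exponents are natural numbers: 7 stands for -1, and - w is w^5. *)
Definition expx0 (j : nat) := j.-1.
Definition expx1 (j : nat) := (5 + 7 * j.-1)%N.
Definition expy0 (j : nat) := (5 * j.-1)%N.

Lemma ketx0E : ketx K 0 = phasev expx0.
Proof.
rewrite /ketx /phasev mul1r; congr (_ *: _).
apply: eq_big_nat => j /andP[j_gt0 _]; congr (_ *: _).
by rewrite expr0 mul1r -predn_int.
Qed.

Lemma ketx1E : ketx K 1 = phasev expx1.
Proof.
rewrite /ketx /phasev mulrC -scalerA scaler_sumr; congr (_ *: _).
apply: eq_big_nat => j /andP[j_gt0 _]; rewrite scalerA; congr (_ *: _).
rewrite expr1 mulN1r -predn_int // -exprnN /expx1 exprD (exprM _ 7%N).
congr (_ * _); rewrite -exprVn; congr (_ ^+ _).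
(* What remains is w^-1 = w^7. *)
by apply: (mulfI w_neq0); rewrite divff ?w_neq0 // -exprS w_exp8.
Qed.

Lemma kety0E : kety0 K = phasev expy0.
Proof.
rewrite /kety0 /phasev; congr (_ *: _).
apply: eq_big_nat => j _; congr (_ *: _).
by rewrite subn1 /expy0 exprM exprS w_exp4 mulrN1.
Qed.

(** The factor [w] raises the exponent j - 1 of x_0 to j, hence [id]. *)
Lemma kety1E : kety1 K = phasev id.
Proof.
rewrite /kety1 ketx0E /phasev scalerA mulrC -scalerA scaler_sumr.
congr (_ *: _); apply: eq_big_nat => j /andP[j_gt0 _].
by rewrite scalerA -exprS prednK.
Qed.

Lemma tensv_mul (m n : nat) (A : 'M[K[i]]_m) (B : 'M[K[i]]_n) u u' v v' c d :
  A *m u = c *: u' -> B *m v = d *: v' ->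
  (A *t B) *m tensv u v = (c * d) *: tensv u' v'.
Proof.
move=> Au Bv; rewrite [LHS](tensmx_mul A B u v) Au Bv.
exact: (scaler_tens c d u' v').
Qed.

(** * From phases on [a] and [b] to logical gates *)

Let a := tensv (phasev expx0) (phasev expy0).
Let b := tensv (phasev expx1) (phasev id).

Lemma gate_of_matrix (A : 'M[K[i]]_(qdim 8 * qdim 8))
    (G : 'M[K[i]]_2) p q r s :
  A *m a = p *: a + q *: b -> A *m b = r *: a + s *: b ->
  p + r = G 0 0 + w ^+ 2 * G 1 0 -> q + s = G 0 0 - w ^+ 2 * G 1 0 ->
  w ^+ 2 * (p - r) = G 0 1 + w ^+ 2 * G 1 1 ->
  w ^+ 2 * (q - s) = G 0 1 - w ^+ 2 * G 1 1 ->
  acts_as_gate A G.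
Proof.
(* The gates hold exactly, with global phase 1. *)
move=> Aa Ab e1 e2 e3 e4; exists 1; split=> [|k]; first exact: normr1.
rewrite scale1r; move: k; apply: mulmx_plane Aa Ab e1 e2 e3 e4.
- by rewrite /ketH /ket0H ketx0E ketx1E kety0E kety1E.
- by rewrite /ketH /ket1H ketx0E ketx1E kety0E kety1E w_sqr.
Qed.

(** The case of H, Z and X: exchanging the two lines makes the diagonal coefficients zero. *)
Lemma gate_of_swap (A : 'M[K[i]]_(qdim 8 * qdim 8))
    (G : 'M[K[i]]_2) q r :
  A *m a = q *: b -> A *m b = r *: a ->
  r = G 0 0 + w ^+ 2 * G 1 0 -> q = G 0 0 - w ^+ 2 * G 1 0 ->
  - w ^+ 2 * r = G 0 1 + w ^+ 2 * G 1 1 ->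
  w ^+ 2 * q = G 0 1 - w ^+ 2 * G 1 1 ->
  acts_as_gate A G.
Proof.
move=> Aa Ab e1 e2 e3 e4; apply: (@gate_of_matrix _ _ 0 q r 0).
- by rewrite Aa [0 *: a]scale0r [RHS]add0r.
- by rewrite Ab [0 *: b]scale0r [RHS]addr0.
- by rewrite add0r.
- by rewrite addr0.
- by rewrite sub0r mulrN -mulNr.
- by rewrite subr0.
Qed.

End EighthRoot.

Theorem mainTheorem4 (K : realType) :
  let U := cycq K [:: 1; 6]%N *m cycq K [:: 2; 5]%N
           *m cycq K [:: 3; 4]%N *m cycq K [:: 7; 8]%N in
  let Q := cycq K [:: 2; 6]%N *m cycq K [:: 4; 8]%N in
  let R := cycq K [:: 1; 7]%N *m cycq K [:: 2; 6]%N *m cycq K [:: 3; 5]%N in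
  let I8 : 'M[K[i]]_(qdim 8) := 1%:M in
  let LH := U *t Q in
  let LZ := R *t Q in
  let LX := (U *m R *m U) *t Q in
  let LY := (U *m R *m U *m R) *t I8 in
  [/\ acts_as_gate LH (gateH K),
      acts_as_gate LZ (gateZ K),
      LX = (cycq K [:: 1; 5]%N *m cycq K [:: 2; 4]%N *m cycq K [:: 6; 8]%N) *t Q
        /\ acts_as_gate LX (gateX K)
    & LY = (cycq K [:: 1; 7; 5; 3]%N *m cycq K [:: 2; 8; 6; 4]%N) *t I8
        /\ acts_as_gate LY (gateX K *m gateZ K)].
Proof.
move=> U Q R I8 LH LZ LX LY.
have w4 := w_exp4 K.
(* Modulo 8, [U] is j -> 7 - j, [Q] is j -> 5j - 4 and [R] is j -> -j. Thus [U] and [R] reverse the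
   sign of j in the exponents, exchanging x_0 and x_1, while [Q] exchanges the slopes 1 and 5 of y_1
   and y_0. *)
have rU : relabels U (next [:: 1; 6] \o next [:: 2; 5] \o next [:: 3; 4]
                      \o next [:: 7; 8])%N.
  by do !apply: relabels_mul; apply: relabels_cycq.
have rQ : relabels Q (next [:: 2; 6] \o next [:: 4; 8])%N.
  by apply: relabels_mul; apply: relabels_cycq.
have rR : relabels R (next [:: 1; 7] \o next [:: 2; 6] \o next [:: 3; 5])%N.
  by do !apply: relabels_mul; apply: relabels_cycq.
(* Modulo 8, URU is j -> 6 - j and URUR is the shift j -> j + 6. *)
have rURU := relabels_mul (relabels_mul rU rR) rU.
have rURUR := relabels_mul rURU rR.
have Qy0 : Q *m phasev K expy0 = w K ^+ 7 *: phasev K id.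
  by apply: relabels_phasev rQ _; vm_compute.
have Qy1 : Q *m phasev K id = w K ^+ 1 *: phasev K expy0.
  by apply: relabels_phasev rQ _; vm_compute.
have I8_phasev f : I8 *m phasev K f = 1 *: phasev K f.
  by rewrite mul1mx scale1r.
split.
- have Ux0 : U *m phasev K expx0 = w K ^+ 0 *: phasev K expx1.
    by apply: relabels_phasev rU _; vm_compute.
  have Ux1 : U *m phasev K expx1 = w K ^+ 0 *: phasev K expx0.
    by apply: relabels_phasev rU _; vm_compute.
  have r_neq0 : sqrtC 2 != 0 :> K[i] by rewrite sqrtC_eq0 pnatr_eq0.
  (* Since w^2 = i, these are (1 + i) / sqrt 2 and (i - 1) / sqrt 2; the swap phases are [w] and w^7
     = -w^3. *)
  have w1E : w K = (sqrtC 2)^-1 * (1 + w K ^+ 2).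
    by apply: (mulfI r_neq0); rewrite mulVKf // sqrtC2_w; ring: w4.
  have w3E : w K ^+ 3 = (sqrtC 2)^-1 * (w K ^+ 2 - 1).
    by apply: (mulfI r_neq0); rewrite mulVKf // sqrtC2_w; ring: w4.
  apply: gate_of_swap (tensv_mul Ux0 Qy0) (tensv_mul Ux1 Qy1) _ _ _ _;
    rewrite !mxE /= expr0 mul1r.
  + by rewrite expr1 {1}w1E; ring.
  + by rewrite (_ : w K ^+ 7 = - w K ^+ 3); [rewrite w3E; ring | ring: w4].
  + by rewrite (_ : - _ * _ = - w K ^+ 3); [rewrite w3E; ring | ring].
  + by rewrite (_ : w K ^+ 2 * _ = w K); [rewrite {1}w1E; ring | ring: w4].
- have Rx0 : R *m phasev K expx0 = w K ^+ 1 *: phasev K expx1.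
    by apply: relabels_phasev rR _; vm_compute.
  have Rx1 : R *m phasev K expx1 = w K ^+ 7 *: phasev K expx0.
    by apply: relabels_phasev rR _; vm_compute.
  apply: gate_of_swap (tensv_mul Rx0 Qy0) (tensv_mul Rx1 Qy1) _ _ _ _;
    rewrite !mxE /=; ring: w4.
- split.
    congr (_ *t _); apply: eq_relabels rURU _ _;
      first by do !apply: relabels_mul; apply: relabels_cycq.
    by vm_compute.
  have x0 : U *m R *m U *m phasev K expx0 = w K ^+ 7 *: phasev K expx1.
    by apply: relabels_phasev rURU _; vm_compute.
  have x1 : U *m R *m U *m phasev K expx1 = w K ^+ 1 *: phasev K expx0.
    by apply: relabels_phasev rURU _; vm_compute.
  apply: gate_of_swap (tensv_mul x0 Qy0) (tensv_mul x1 Qy1) _ _ _ _;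
    rewrite !mxE /=; ring: w4.
- split.
    congr (_ *t _); apply: eq_relabels rURUR _ _;
      first by do !apply: relabels_mul; apply: relabels_cycq.
    by vm_compute.
  have x0 : U *m R *m U *m R *m phasev K expx0 = w K ^+ 2 *: phasev K expx0.
    by apply: relabels_phasev rURUR _; vm_compute.
  have x1 : U *m R *m U *m R *m phasev K expx1 = w K ^+ 6 *: phasev K expx1.
    by apply: relabels_phasev rURUR _; vm_compute.
  (* Each line is preserved, with eigenvalues w^2 = i and w^6 = -i. *)
  apply: (gate_of_matrix (p := w K ^+ 2) (q := 0) (r := 0) (s := w K ^+ 6)).
  + rewrite (tensv_mul x0 (I8_phasev expy0)) mulr1.
    by rewrite [0 *: _]scale0r [RHS]addr0.
  + rewrite (tensv_mul x1 (I8_phasev id)) mulr1.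
    by rewrite [0 *: _]scale0r [RHS]add0r.
  all: rewrite !mxE !big_ord_recl !big_ord0 !mxE /=; ring: w4.
Qed.
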